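(* Let $\mathfrak{h}$ be a finite-dimensional real Lie algebra and let $T\mathfrak{h}=\mathfrak{h}\ltimes_{\mathrm{ad}}V$ be its tangent Lie algebra, where $V$ is the underlying vector space of $\mathfrak{h}$. The set of totally real complex structures on $T\mathfrak{h}$ is in one-to-one correspondence with the set of non-singular derivations of $\mathfrak{h}$, the correspondence sending $J$ to the linear map $j:\mathfrak{h}\to V=\mathfrak{h}$ obtained by restricting $J$ to $\mathfrak{h}$. If one (and therefore both) of these sets is non-empty, then $\mathfrak{h}$ is nilpotent.
   Context: The tangent Lie algebra $T\mathfrak{h}=\mathfrak{h}\ltimes_{\mathrm{ad}}V$ is the vector space $\mathfrak{h}\oplus V$, $V=\mathfrak{h}$ as a vector space, with bracket $[(x,v),(x',v')]=([x,x'],[x,v']-[x',v])$ (so $V$ is an abelian ideal). A complex structure on a real Lie algebra $\mathfrak{g}$ is a linear map $J:\mathfrak{g}\to\mathfrak{g}$ with $J^2=-\mathrm{I}$ and $[Jx,Jy]-[x,y]-J[Jx,y]-J[x,Jy]=0$ for all $x,y\in\mathfrak{g}$. A complex structure $J$ on $T\mathfrak{h}$ is totally real if $J\mathfrak{h}=V$; then $J(x,v)=(-j^{-1}v,jx)$ for a linear isomorphism $j:\mathfrak{h}\to V$. A derivation of $\mathfrak{h}$ is a linear map $d$ with $d[x,y]=[dx,y]+[x,dy]$; it is non-singular if it is invertible. *)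

(* Defs.v *)
From HB Require Import structures.
From mathcomp Require Import all_boot all_order all_algebra.
From mathcomp Require Import boolp classical_sets functions reals.

Set Implicit Arguments.
Unset Strict Implicit.
Unset Printing Implicit Defensive.

Import GRing.Theory.
Local Open Scope ring_scope.

HB.mixin Record isLieAlgebra (K : fieldType) L of Vector K L := {
  lie : L -> L -> L;
  lieDl : forall x y z, lie (x + y) z = lie x z + lie y z;
  lieZl : forall a x y, lie (a *: x) y = a *: lie x y;
  lieDr : forall x y z, lie x (y + z) = lie x y + lie x z;
  lieZr : forall a x y, lie x (a *: y) = a *: lie x y;
  liexx : forall x, lie x x = 0;
  lie_jacobi : forall x y z,
    lie x (lie y z) + lie y (lie z x) + lie z (lie x y) = 0
}.

(* Lie algebras are finite-dimensional here: the carrier is a [vectType]. *)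
#[short(type="lieAlgType")]
HB.structure Definition LieAlgebra (K : fieldType) :=
  { L of isLieAlgebra K L & Vector K L }.

Lemma lieNl (K : fieldType) (L : lieAlgType K) (x y : L) :
  lie (- x) y = - lie x y.
Proof. by rewrite -scaleN1r lieZl scaleN1r. Qed.

Lemma lieNr (K : fieldType) (L : lieAlgType K) (x y : L) :
  lie x (- y) = - lie x y.
Proof. by rewrite -scaleN1r lieZr scaleN1r. Qed.

Lemma lieC (K : fieldType) (L : lieAlgType K) (x y : L) :
  lie x y = - lie y x.
Proof.
by apply/eqP; rewrite -addr_eq0; have := liexx (x + y);
  rewrite lieDl !lieDr !liexx add0r addr0 => ->.
Qed.

(* The span of all brackets [lie x y] with [x] in [U] and [y] in [W]; bases
   suffice by bilinearity, see [lie_prod_subP]. *)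
Definition lie_prod (K : fieldType) (L : lieAlgType K) (U W : {vspace L}) :
    {vspace L} :=
  <<[seq lie x y | x <- vbasis U, y <- vbasis W]>>%VS.

Lemma lie_prod_subP (K : fieldType) (L : lieAlgType K) (U W Z : {vspace L}) :
  reflect (forall x y, x \in U -> y \in W -> lie x y \in Z)
          (lie_prod U W <= Z)%VS.
Proof.
apply: (iffP span_subvP) => [sZ x y Ux Wy | sZ _ /allpairsP[[x y] /= [Ux Wy ->]]];
  last by apply: sZ; apply: vbasis_mem.
have suml (I : Type) (r : seq I) (F : I -> L) z :
    lie (\sum_(i <- r) F i) z = \sum_(i <- r) lie (F i) z.
  apply: (big_morph (fun u => lie u z)) => [u v|]; first exact: lieDl.
  by rewrite -(scale0r (0 : L)) lieZl !scale0r.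
have sumr (I : Type) (r : seq I) (F : I -> L) z :
    lie z (\sum_(i <- r) F i) = \sum_(i <- r) lie z (F i).
  apply: (big_morph (lie z)) => [u v|]; first exact: lieDr.
  by rewrite -(scale0r (0 : L)) lieZr !scale0r.
rewrite (coord_vbasis Ux) (coord_vbasis Wy) suml memv_suml // => i _.
rewrite sumr memv_suml // => j _.
rewrite lieZl lieZr !memvZ //; apply: sZ.
by apply/allpairsP; exists ((vbasis U)`_i, (vbasis W)`_j);
  split=> //=; rewrite mem_nth ?size_tuple.
Qed.

Definition lower_central (K : fieldType) (L : lieAlgType K) (n : nat) :
    {vspace L} :=
  iter n (lie_prod fullv) fullv.

Definition lie_nilpotent (K : fieldType) (L : lieAlgType K) : Prop :=
  exists n, lower_central L n = 0%VS.

Definition derivation (K : fieldType) (L : lieAlgType K) (d : 'End(L)) : Prop :=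
  forall x y, d (lie x y) = lie (d x) y + lie x (d y).

Definition nonsingular (K : fieldType) (L : vectType K) (d : 'End(L)) : Prop :=
  exists e : 'End(L), (e \o d = \1)%VF /\ (d \o e = \1)%VF.

Definition complex_structure (K : fieldType) (L : lieAlgType K)
    (J : 'End(L)) : Prop :=
  (J \o J)%VF = - \1%VF /\
  forall x y, lie (J x) (J y) - lie x y - J (lie (J x) y) - J (lie x (J y)) = 0.

(* The pair [(x, v)] is the element [x + v] of h (+) V, with V = h as a vector
   space; the alias carries the semidirect bracket, not a componentwise one. *)
Definition tangent (K : fieldType) (h : lieAlgType K) : Type := (h * h)%type.

HB.instance Definition _ (K : fieldType) (h : lieAlgType K) :=
  Vector.copy (tangent h) (h * h)%type.

Definition tangent_lie (K : fieldType) (h : lieAlgType K) (p q : tangent h) :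
    tangent h :=
  (lie p.1 q.1, lie p.1 q.2 - lie q.1 p.2).

Lemma tangent_lieDl (K : fieldType) (h : lieAlgType K) (x y z : tangent h) :
  tangent_lie (x + y) z = tangent_lie x z + tangent_lie y z.
Proof.
congr pair => /=; first exact: lieDl.
by rewrite lieDl lieDr opprD addrACA.
Qed.

Lemma tangent_lieZl (K : fieldType) (h : lieAlgType K) a (x y : tangent h) :
  tangent_lie (a *: x) y = a *: tangent_lie x y.
Proof.
congr pair => /=; first exact: lieZl.
by rewrite lieZl lieZr scalerBr.
Qed.

Lemma tangent_lieDr (K : fieldType) (h : lieAlgType K) (x y z : tangent h) :
  tangent_lie x (y + z) = tangent_lie x y + tangent_lie x z.
Proof.
congr pair => /=; first exact: lieDr.
by rewrite lieDl lieDr opprD addrACA.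
Qed.

Lemma tangent_lieZr (K : fieldType) (h : lieAlgType K) a (x y : tangent h) :
  tangent_lie x (a *: y) = a *: tangent_lie x y.
Proof.
congr pair => /=; first exact: lieZr.
by rewrite lieZl lieZr scalerBr.
Qed.

Lemma tangent_liexx (K : fieldType) (h : lieAlgType K) (x : tangent h) :
  tangent_lie x x = 0.
Proof. by congr pair => /=; rewrite ?liexx ?subrr. Qed.

Lemma lie_jacobi_ad (K : fieldType) (L : lieAlgType K) (x y z : L) :
  lie (lie x y) z = lie x (lie y z) - lie y (lie x z).
Proof.
apply/eqP; rewrite -subr_eq0 -oppr_eq0 -(lie_jacobi x y z).
by rewrite (lieC z (lie x y)) (lieC z x) lieNr opprB addrC.
Qed.

Lemma tangent_jacobi (K : fieldType) (h : lieAlgType K) (x y z : tangent h) :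
  tangent_lie x (tangent_lie y z) + tangent_lie y (tangent_lie z x)
  + tangent_lie z (tangent_lie x y) = 0.
Proof.
congr pair => /=; first exact: lie_jacobi.
rewrite !lie_jacobi_ad !lieDr !lieNr !opprB.
set a := lie x.1 (lie y.1 z.2); set b := lie x.1 (lie z.1 y.2).
set c := lie y.1 (lie z.1 x.2); set d := lie z.1 (lie y.1 x.2).
set e := lie y.1 (lie x.1 z.2); set f := lie z.1 (lie x.1 y.2).
have -> : a - b + (d - c) + (c - e + (b - f)) = a - f + (d - e).
  by rewrite [c - e + _]addrC addrACA !addrA !subrK.
by rewrite addrACA !addrA !subrK subrr.
Qed.

HB.instance Definition _ (K : fieldType) (h : lieAlgType K) :=
  isLieAlgebra.Build K (tangent h) (@tangent_lieDl K h) (@tangent_lieZl K h)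
    (@tangent_lieDr K h) (@tangent_lieZr K h) (@tangent_liexx K h)
    (@tangent_jacobi K h).

Definition tangent_base (K : fieldType) (h : lieAlgType K) (x : h) :
    tangent h := (x, 0).

Definition tangent_fibre (K : fieldType) (h : lieAlgType K) (v : h) :
    tangent h := (0, v).

Lemma tangent_base_is_linear (K : fieldType) (h : lieAlgType K) :
  linear (@tangent_base K h).
Proof. by move=> a x y; congr pair => /=; rewrite scaler0 addr0. Qed.

Lemma tangent_fibre_is_linear (K : fieldType) (h : lieAlgType K) :
  linear (@tangent_fibre K h).
Proof. by move=> a x y; congr pair => /=; rewrite scaler0 addr0. Qed.

Definition tangent_snd (K : fieldType) (h : lieAlgType K) (p : tangent h) : h :=
  p.2.

Lemma tangent_snd_is_linear (K : fieldType) (h : lieAlgType K) :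
  linear (@tangent_snd K h).
Proof. by []. Qed.

HB.instance Definition _ (K : fieldType) (h : lieAlgType K) :=
  GRing.isLinear.Build K h (tangent h) _ (@tangent_base K h)
    (@tangent_base_is_linear K h).

HB.instance Definition _ (K : fieldType) (h : lieAlgType K) :=
  GRing.isLinear.Build K h (tangent h) _ (@tangent_fibre K h)
    (@tangent_fibre_is_linear K h).

HB.instance Definition _ (K : fieldType) (h : lieAlgType K) :=
  GRing.isLinear.Build K (tangent h) h _ (@tangent_snd K h)
    (@tangent_snd_is_linear K h).

Definition totally_real (K : fieldType) (h : lieAlgType K)
    (J : 'End(tangent h)) : Prop :=
  (J @: limg (linfun (@tangent_base K h)))%VS
  = limg (linfun (@tangent_fibre K h)).

(* The restriction of [J] to h, read in V = h through the second component.
   When [J] is totally real, no information is lost: J (x, 0) = (0, j x). *)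
Definition restriction (K : fieldType) (h : lieAlgType K)
    (J : 'End(tangent h)) : 'End(h) :=
  (linfun (@tangent_snd K h) \o J \o linfun (@tangent_base K h))%VF.

Lemma restrictionE (K : fieldType) (h : lieAlgType K) (J : 'End(tangent h))
    (x : h) :
  restriction J x = (J (tangent_base x)).2.
Proof. by rewrite !comp_lfunE !lfunE. Qed.

Lemma totally_realE (K : fieldType) (h : lieAlgType K) (J : 'End(tangent h))
    (x : h) :
  totally_real J -> J (tangent_base x) = tangent_fibre (restriction J x).
Proof.
move=> tJ; have : J (tangent_base x) \in limg (linfun (@tangent_fibre K h)).
  by rewrite -tJ memv_img // -(lfunE (@tangent_base K h)) memv_img ?memvf.
by case/memv_imgP=> v _; rewrite lfunE restrictionE /= => ->.
Qed.

Definition totally_real_complex_structures (K : fieldType) (h : lieAlgType K) :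
    set 'End(tangent h) :=
  [set J | complex_structure J /\ totally_real J]%classic.

Definition nonsingular_derivations (K : fieldType) (h : lieAlgType K) :
    set 'End(h) :=
  [set d | derivation d /\ nonsingular d]%classic.

Arguments totally_real_complex_structures {K} h _.
Arguments nonsingular_derivations {K} h _.

(* Main.v *)
(** Evaluating integrability of J on h, where J (x, 0) = (0, j x) and V is
    abelian, gives exactly the derivation identity for j; conversely
    J (x, v) = (- j^-1 v, j x) is integrable when j is a non-singular derivation.

    Nilpotency is Jacobson's theorem.  After complexification, h is spanned by
    the generalized eigenvectors of j, and brackets add eigenvalues.  As 0 is not
    an eigenvalue and there are finitely many, ad x is nilpotent for each
    generalized eigenvector x; these are closed under brackets, so the weakly
    closed form of Engel's theorem applies. *)

From HB Require Import structures.
Require Import Defs.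
From mathcomp Require Import all_boot all_order all_algebra.
From mathcomp Require Import boolp classical_sets functions reals.
From mathcomp Require Import complex ssrAC.

Set Implicit Arguments.
Unset Strict Implicit.
Unset Printing Implicit Defensive.

Import Order.TTheory GRing.Theory Num.Theory VectorInternalTheory.
Local Open Scope ring_scope.

(** * Linearity of the bracket and spanning subsets *)

Section Adjoint.
Variables (K : fieldType) (L : lieAlgType K).
Implicit Types (x y z : L) (U W : {vspace L}).

(** The flipped bracket is named so that linearity in the left argument can be registered as an
    instance. *)
Definition rlie y x := lie x y.

Lemma lie_is_linear x : linear (lie x).
Proof. by move=> a y z; rewrite lieDr lieZr. Qed.

Lemma rlie_is_linear y : linear (rlie y).
Proof. by move=> a x z; rewrite /rlie lieDl lieZl. Qed.

HB.instance Definition _ x :=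
  GRing.isLinear.Build K L L _ (lie x) (lie_is_linear x).

HB.instance Definition _ y :=
  GRing.isLinear.Build K L L _ (rlie y) (rlie_is_linear y).

Lemma lie0l y : lie 0 y = 0.
Proof. exact: (linear0 (rlie y)). Qed.

Lemma lie_derivation x y z : lie x (lie y z) = lie (lie x y) z + lie y (lie x z).
Proof. by rewrite lie_jacobi_ad subrK. Qed.

Lemma lie_prod_mem U W x y : x \in U -> y \in W -> lie x y \in lie_prod U W.
Proof. exact: (lie_prod_subP _ _ _ (subvv _)). Qed.

Lemma lie_prodSr U W W' : (W <= W')%VS -> (lie_prod U W <= lie_prod U W')%VS.
Proof.
by move=> sW; apply/lie_prod_subP=> x y Ux Wy; rewrite lie_prod_mem ?(subvP sW).
Qed.

Lemma iter_lie_prodSr U W W' n :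
  (W <= W')%VS -> (iter n (lie_prod U) W <= iter n (lie_prod U) W')%VS.
Proof. by move=> sW; elim: n => //= n IHn; apply: lie_prodSr. Qed.

(* [U] is spanned by those of its elements that satisfy [H]. *)
Definition spanned_by (H : L -> Prop) U :=
  forall Z : {vspace L},
    (forall x, H x -> x \in U -> x \in Z) -> (U <= Z)%VS.

(** With one argument fixed, bracketing into [Z] is membership in a linear preimage of [Z], so each
    argument in turn may be taken in [H]. *)
Lemma spanned_by_lie_prod (H : L -> Prop) U W :
    (forall x y, H x -> H y -> H (lie x y)) ->
  spanned_by H U -> spanned_by H W -> spanned_by H (lie_prod U W).
Proof.
move=> Hlie HU HW Z HZ.
have preimE (f : {linear L -> L}) v :
  (v \in (linfun f @^-1: Z)%VS) = (f v \in Z) by rewrite -memv_preim lfunE.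
apply/lie_prod_subP=> x y Ux Wy; rewrite -(preimE (rlie y)).
apply: subvP Ux; apply: HU => {}x Hx Ux; rewrite preimE /= -(preimE (lie x)).
apply: subvP Wy; apply: HW => {}y Hy Wy; rewrite preimE /=.
by apply: HZ; [apply: Hlie | apply: lie_prod_mem].
Qed.

End Adjoint.

(** * Engel's theorem for bracket-closed spanning sets *)

Section Engel.
Variables (K : fieldType) (L : lieAlgType K).
Implicit Types (x y z s t : L) (T U W : {vspace L}).

Lemma iter_lie_prod_decr T n :
  (iter n.+1 (lie_prod T) fullv <= iter n (lie_prod T) fullv)%VS.
Proof. by rewrite iterSr; apply: iter_lie_prodSr; rewrite subvf. Qed.

(** [ad s] is a derivation of the bracket and preserves [T], hence it preserves every iterated
    product with [T]. *)
Lemma iter_lie_prod_stable T s n v :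
    (forall t, t \in T -> lie s t \in T) ->
  v \in iter n (lie_prod T) fullv -> lie s v \in iter n (lie_prod T) fullv.
Proof.
move=> sT; elim: n v => [|n IHn] v; first by move=> _; apply: memvf.
rewrite -(lfunE (lie s)) memv_preim.
apply: subvP; apply/lie_prod_subP => t w Tt Vw.
rewrite -memv_preim lfunE /= lie_derivation.
by rewrite memvD ?lie_prod_mem ?sT ?IHn.
Qed.

Lemma mem_iter_lfun_img (f : 'End(L)) n U v :
  v \in iter n (lfun_img f) U -> exists w, v = iter n f w.
Proof.
elim: n v => [|n IHn] v /=; first by exists v.
by case/memv_imgP=> w /IHn[u ->] ->; exists u.
Qed.

(** Modulo the next iterated product, [T] kills the [n]-th one, so [T + <[s]>] acts on it through
    multiples of [ad s], and [m] such steps give zero. *)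
Lemma iter_lie_prod_add_line T s m n :
    (forall t, t \in T -> lie s t \in T) ->
    (forall v, iter m (lie s) v = 0) ->
  (iter m (lie_prod (T + <[s]>)) (iter n (lie_prod T) fullv)
     <= iter n.+1 (lie_prod T) fullv)%VS.
Proof.
move=> sT nil_s; set U := (T + <[s]>)%VS.
pose V i : {vspace L} := iter i (lie_prod T) fullv.
pose A k : {vspace L} := iter k (lfun_img (linfun (lie s))) (V n).
rewrite -/(V n) -/(V n.+1).
have sAV k : (A k <= V n)%VS.
  elim: k => [|k IHk]; first exact: subvv.
  apply/subvP=> _ /memv_imgP[w /(subvP IHk) Vw ->]; rewrite lfunE /=.
  exact: iter_lie_prod_stable.
suffices step k : (iter k (lie_prod U) (V n) <= A k + V n.+1)%VS.
  apply: subv_trans (step m) _; rewrite subv_add subvv andbT.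
  apply/subvP=> v /mem_iter_lfun_img[w ->].
  have -> : iter m (linfun (lie s)) w = iter m (lie s) w.
    by apply: eq_iter => u; rewrite lfunE.
  by rewrite nil_s mem0v.
elim: k => [|k IHk]; first exact: addvSl.
rewrite iterS; apply: (subv_trans (lie_prodSr U IHk)) => {IHk}.
apply/lie_prod_subP=> _ y /memv_addP[t Tt [_ /vlineP[c ->] ->]].
case/memv_addP=> a Aa [b Vb ->] {y}.
(* Of the four terms, [c [s, a]] lands in [A k.+1]; the other three lie in [V n.+1]. *)
rewrite lieDr [lie _ a]lieDl lieDl !lieZl -addrA addrCA memv_add //.
  by apply: memvZ; rewrite -(lfunE (lie s)) memv_img.
apply: memvD; first by apply: lie_prod_mem; rewrite ?(subvP (sAV k)).
apply: memvD; last by apply/memvZ/iter_lie_prod_stable.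
by apply: lie_prod_mem; rewrite // (subvP (iter_lie_prod_decr T n)).
Qed.

(* A maximal subspace [T] spanned by elements of [H] and acting nilpotently must
   be [L]: if [V_i = ad(T)^i L] and [i] is least with [V_(i+1)] inside [T], adding
   to [T] an element of [H] in [V_i] outside [T] preserves both properties.

   Jacobson's form of Engel's theorem: nilpotency of [ad x] is only required
   on a spanning set closed under brackets, not on its linear combinations. *)
Theorem engel_weakly_closed (H : L -> Prop) :
    (forall x y, H x -> H y -> H (lie x y)) ->
    spanned_by H fullv ->
    (forall x, H x -> exists m, forall v, iter m (lie x) v = 0) ->
  lie_nilpotent L.
Proof.
move=> Hlie Hfull Hnil.
suffices chain n : (n <= \dim {:L})%N -> exists T, [/\ spanned_by H T,
    exists k, iter k (lie_prod T) fullv = 0%VS & (n <= \dim T)%N].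
  have [T [_ [k nilT] leT]] := chain _ (leqnn _); exists k.
  have fullT : T = fullv by apply/eqP; rewrite eqEdim subvf.
  by rewrite fullT in nilT.
elim: n => [_|n IHn ltn].
  exists 0%VS; split=> //; first by move=> Z _; apply: sub0v.
  exists 1; apply/eqP; rewrite -subv0; apply/lie_prod_subP=> x y.
  by rewrite memv0 => /eqP-> _; rewrite lie0l mem0v.
have [T [HT [N nilT] leT]] := IHn (ltnW ltn).
have [ltT|geT] := ltnP n (\dim T); first by exists T; split=> //; exists N.
pose V i : {vspace L} := iter i (lie_prod T) fullv.
have HV i : spanned_by H (V i).
  by elim: i => //= i IHi; apply: spanned_by_lie_prod.
have exT : exists i, (V i <= T)%VS by exists N; rewrite /V nilT sub0v.
(* Index 0 would put the whole space inside [T], against the dimension bound. *)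
case: (ex_minnP exT) => -[|i] sVT minV.
  by have := leq_trans ltn (dimvS sVT); rewrite ltnNge geT.
have [s [Hs Vs nTs]] : exists s, [/\ H s, s \in V i & s \notin T].
  apply: contrapT => noS; suff /minV : (V i <= T)%VS by rewrite ltnn.
  apply: HV => x Hx Vx; apply: contrapT => /negP nTx.
  by apply: noS; exists x.
(* Since [s] is in [V i], the bracket [[t, s]] lies in [V i.+1], which is inside [T]. *)
have sT t : t \in T -> lie s t \in T.
  by move=> Tt; rewrite lieC rpredN (subvP sVT) ?lie_prod_mem.
have [m nil_s] := Hnil s Hs.
exists (T + <[s]>)%VS; split.
- move=> Z HZ; rewrite subv_add -memvE.
  rewrite HZ ?andbT //; first last.
    by rewrite (subvP (addvSr _ _)) ?memv_line.
  by apply: HT => x Hx Tx; rewrite HZ // (subvP (addvSl _ _)).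
(* Each block of [m] brackets with the larger space descends one step in the series of [T], which
   reaches zero after [N] steps. *)
- exists (N * m)%N; apply/eqP; rewrite -subv0 -nilT.
  elim: (N) => [|j IHj]; first exact: subvv.
  rewrite mulSn iterD; apply: (subv_trans (iter_lie_prodSr _ _ IHj)).
  exact: iter_lie_prod_add_line.
- apply: leq_ltn_trans leT _; rewrite ltnNge; apply: contra nTs => ledim.
  have/eqP eqT : T == (T + <[s]>)%VS by rewrite eqEdim addvSl.
  by rewrite eqT (subvP (addvSr _ _)) ?memv_line.
Qed.

End Engel.

(** * Generalized eigenvectors of an endomorphism *)

Section GeneralizedEigenvectors.
Variables (K : fieldType) (V : vectType K) (d : 'End(V)).
Implicit Types (a b : K) (u v w x : V) (r : seq K) (s : seq V).

Lemma iter_linear (f : {linear V -> V}) k a u v :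
  iter k f (a *: u + v) = a *: iter k f u + iter k f v.
Proof. by elim: k => //= k ->; rewrite linearP. Qed.

Lemma iter_linear0 (f : {linear V -> V}) k : iter k f 0 = 0.
Proof. by elim: k => //= k ->; rewrite linear0. Qed.

Definition eigen_shift a v := d v - a *: v.

Lemma eigen_shift_is_linear a : linear (eigen_shift a).
Proof.
move=> c u v; rewrite /eigen_shift linearP scalerDr opprD addrACA scalerBr.
by rewrite !scalerA mulrC.
Qed.

HB.instance Definition _ a :=
  GRing.isLinear.Build K V V _ (eigen_shift a) (eigen_shift_is_linear a).

(** Zero is included for every [a], so that closure under sums and brackets holds without
    exception. *)
Definition gen_eigenvector a v := exists k, iter k (eigen_shift a) v = 0.

Lemma gen_eigenvectorD a u v :
  gen_eigenvector a u -> gen_eigenvector a v -> gen_eigenvector a (u + v).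
Proof.
move=> [k uk] [m vm]; exists (k + m)%N.
rewrite -[u]scale1r iter_linear scale1r addnC {1}iterD uk iter_linear0 add0r.
by rewrite addnC iterD vm iter_linear0.
Qed.

(** On the kernel of [(d - a)^k], [d - b] is the nonzero scalar [a - b] plus a nilpotent operator,
    hence invertible. *)
Lemma gen_eigenvector_shift_preim a b k u : a != b ->
    iter k (eigen_shift a) u = 0 ->
  exists2 w, iter k (eigen_shift a) w = 0 & u = eigen_shift b w.
Proof.
move=> neq_ab; elim: k u => [|k IHk] u; first by exists 0; rewrite ?linear0.
rewrite iterSr => uk; have [w wk Dw] := IHk _ uk.
(* From [(d - a) u = (d - b) w] follows [(d - b) (u - w) = (a - b) u]. *)
exists ((a - b)^-1 *: (u - w)).
  rewrite -[_ *: _]addr0 iter_linear iter_linear0 addr0.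
  rewrite -[u - w]addrC -scaleN1r iter_linear iterS wk linear0 scaler0 add0r.
  by rewrite iterSr uk scaler0.
rewrite linearZ linearB /= -Dw /eigen_shift opprB.
rewrite [X in _ *: X]addrC addrA subrK -scalerBl.
by rewrite scalerA mulVf ?scale1r // subr_eq0.
Qed.

(* If [(d - b) v] is a sum of generalized eigenvectors, those for eigenvalues
   other than [b] lift through [d - b], so [v] minus the lifts is a generalized
   eigenvector for [b]. *)
Lemma foldr_eigen_shift_gen_eigenvector r v :
    foldr eigen_shift v r = 0 ->
  exists2 s, (forall x, x \in s -> exists a, gen_eigenvector a x) &
             v = \sum_(x <- s) x.
Proof.
elim/last_ind: r v => [|r b IHr] v.
  by move=> /= ->; exists [::] => //; rewrite big_nil.
rewrite foldr_rcons => /IHr[s sE Dv].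
suffices [s' s'E [l lE Ds]] : exists2 s',
    (forall x, x \in s' -> exists a, gen_eigenvector a x) &
    exists2 l, gen_eigenvector b l &
    \sum_(x <- s) x = eigen_shift b (\sum_(x <- s') x) + l.
  exists (v - \sum_(x <- s') x :: s') => [x|]; last by rewrite big_cons subrK.
  rewrite inE => /predU1P[->|/s'E //]; exists b.
  case: lE => k lk; exists k.+1.
  by rewrite iterSr linearB /= Dv Ds addrC addKr.
elim: s sE {Dv} => [|x s IHs] sE.
  exists [::] => //; exists 0; first by exists 0.
  by rewrite !big_nil linear0 addr0.
have [|s' s'E [l lE Ds]] := IHs.
  by move=> y sy; apply: sE; rewrite inE sy orbT.
have [a [k xk]] := sE x (mem_head _ _).
have [eq_ab|neq_ab] := eqVneq a b.
  exists s' => //; exists (x + l).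
    by apply: gen_eigenvectorD lE; exists k; rewrite -eq_ab.
  by rewrite big_cons Ds addrCA.
have [w wk Dx] := gen_eigenvector_shift_preim neq_ab xk.
exists (w :: s') => [y|].
  by rewrite inE => /predU1P[->|/s'E //]; exists a, k.
by exists l => //; rewrite !big_cons linearD /= Ds -Dx addrA.
Qed.

(** The last nonzero iterate of [d - a] on [v] is a genuine eigenvector. *)
Lemma gen_eigenvector_neq0 a v : gen_eigenvector a v -> v != 0 ->
  exists2 w, w != 0 & d w = a *: w.
Proof.
case=> k; elim: k => [/= ->|k IHk vk nzv]; first by rewrite eqxx.
have [/IHk|nzw] := eqVneq (iter k (eigen_shift a) v) 0; first exact.
exists (iter k (eigen_shift a) v) => //.
by apply/eqP; rewrite -subr_eq0; apply/eqP.
Qed.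

(** On an eigenvector for [a] the composed shifts act as the product of the scalars [a - b], so one
    factor vanishes. *)
Lemma mem_eigenvalue_annihilator r a w :
    (forall v, foldr eigen_shift v r = 0) -> w != 0 -> d w = a *: w -> a \in r.
Proof.
move=> /(_ w) r0 nzw Dw.
have Er : foldr eigen_shift w r = (\prod_(b <- r) (a - b)) *: w.
  elim: (r) => [|b r' IHr] /=; first by rewrite big_nil scale1r.
  by rewrite big_cons IHr linearZ /= /eigen_shift Dw -scalerBl scalerA mulrC.
move/eqP: r0; rewrite Er scaler_eq0 (negPf nzw) orbF prodf_seq_eq0.
by case/hasP=> b rb; rewrite subr_eq0 => /eqP->.
Qed.

End GeneralizedEigenvectors.

(** Turns successive shifts into a polynomial in [A], so that Cayley-Hamilton applies. *)
Lemma foldr_mulmx_horner (K : fieldType) n (A : 'M[K]_n.+1) (u : 'rV_n.+1) r :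
  foldr (fun a v => v *m A - a *: v) u r
  = u *m horner_mx A (\prod_(a <- r) ('X - a%:P)).
Proof.
elim: r => [|a r IHr] /=; first by rewrite big_nil rmorph1 mulmx1.
rewrite big_cons mulrC rmorphM rmorphB /= horner_mx_X horner_mx_C IHr.
by rewrite -mulmxE mulmxA mulmxBr mul_mx_scalar.
Qed.

(** The characteristic polynomial splits over a closed field; by Cayley-Hamilton its list of roots
    serves as [r]. *)
Lemma closed_eigen_annihilator (K : closedFieldType) (V : vectType K)
    (d : 'End(V)) :
  exists r, forall v, foldr (eigen_shift d) v r = 0.
Proof.
have [r rE] : exists r, forall u : 'rV_(dim V),
    foldr (fun a v => v *m f2mx d - a *: v) u r = 0.
  (* Matrix polynomials require a size [n.+1]; in dimension 0 the empty list works. *)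
  case: (dim V) (f2mx d) => [|n] A.
    by exists [::] => u /=; rewrite thinmx0.
  have [r Dr] := closed_field_poly_normal (char_poly A).
  exists r => u; rewrite foldr_mulmx_horner.
  rewrite (monicP (char_poly_monic A)) scale1r in Dr.
  by rewrite -Dr Cayley_Hamilton mulmx0.
exists r => v; apply: (can_inj v2rK); rewrite linear0 -(rE (v2r v)).
elim: r {rE} => //= a r <-; rewrite linearB linearZ /=; congr (_ - _).
by rewrite unlock /= r2vK.
Qed.

(** * Jacobson's theorem over a closed field of characteristic zero *)

Section JacobsonClosed.
Variables (K : closedFieldType) (L : lieAlgType K) (d : 'End(L)).
Hypotheses (K0 : [pchar K] =i pred0) (der_d : derivation d).
Hypothesis inj_d : forall v, d v = 0 -> v = 0.

(** By the Leibniz rule [(d - (a + b)) [x, y] = [(d - a) x, y] + [x, (d - b) y]]; induction on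
    [k + m] stops once an argument is zero. *)
Lemma gen_eigenvector_lie a b (x y : L) :
    gen_eigenvector d a x -> gen_eigenvector d b y ->
  gen_eigenvector d (a + b) (lie x y).
Proof.
case=> k xk [m ym]; exists (k + m)%N; have [n] := ubnP (k + m)%N.
elim: n k m x y xk ym => // n IHn [|k] m x y xk ym lekm.
  by move: xk => /= ->; rewrite lie0l iter_linear0.
case: m ym lekm => [|m] ym lekm; first by rewrite [y]ym linear0 iter_linear0.
have shift_lie : eigen_shift d (a + b) (lie x y)
    = lie (eigen_shift d a x) y + lie x (eigen_shift d b y).
  rewrite /eigen_shift der_d lieDl lieDr lieNl lieNr lieZl lieZr scalerDl.
  by rewrite opprD addrACA.
rewrite addSn iterSr shift_lie -[lie _ y]scale1r iter_linear scale1r.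
rewrite [X in X + _]IHn ?add0r //; last by rewrite -iterSr.
by rewrite addnS -addSn IHn // -?iterSr // -ltnS -addnS.
Qed.

(** Iterating [ad x] on a generalized eigenvector for [b] runs through the values [b + k a],
    distinct in characteristic zero as [a] is nonzero, while all eigenvalues lie in the finite list
    [r]. *)
Lemma gen_eigenvector_ad_nilpotent a x : gen_eigenvector d a x ->
  exists m, forall v, iter m (lie x) v = 0.
Proof.
move=> ax; have [r rE] := closed_eigen_annihilator d.
have [x0|nzx] := eqVneq x 0; first by exists 1 => v; rewrite x0 /= lie0l.
(* If [a] were zero, [d] would kill a genuine eigenvector. *)
have nza : a != 0.
  apply: contraNneq nzx => a0.
  apply: contraT => nzx; have [w] := gen_eigenvector_neq0 ax nzx.
  by rewrite a0 scale0r => /eqP nzw /inj_d.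
exists (size r) => v; have [s sE ->] := foldr_eigen_shift_gen_eigenvector (rE v).
elim: s sE => [|y s IHs] sE; first by rewrite big_nil iter_linear0.
rewrite big_cons -[y]scale1r iter_linear scale1r.
rewrite IHs ?addr0 => [|z sz]; last by apply: sE; rewrite inE sz orbT.
have [b yb] := sE y (mem_head _ _); apply/eqP/contraT => nzy.
have nzk k : (k <= size r)%N -> iter k (lie x) y != 0.
  move=> lek; apply: contraNneq nzy => y0.
  by rewrite -(subnK lek) iterD y0 iter_linear0.
have eigk k : gen_eigenvector d (b + a *+ k) (iter k (lie x) y).
  elim: k => [|k IHk]; first by rewrite addr0.
  by rewrite mulrS addrCA; apply: gen_eigenvector_lie.
(* With iterates 0 to [size r] nonzero, these are [size r + 1] distinct eigenvalues, one too many
   for [r]. *)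
pose e := [seq b + a *+ k | k <- iota 0 (size r).+1].
have : (size e <= size r)%N.
  apply: uniq_leq_size => [|c /mapP[k]].
    rewrite map_inj_uniq ?iota_uniq // => i j /addrI.
    wlog lij : i j / (i <= j)%N => [wl|].
      by case/orP: (leq_total i j) => /wl // H /esym/H.
    rewrite -(subnK lij) mulrnDr => /esym/eqP; rewrite -subr_eq0 addrK.
    rewrite -mulr_natr mulf_eq0 (negPf nza) /= ((pcharf0P K).1 K0).
    by rewrite subn_eq0 => leji; apply/eqP; rewrite subnK // eqn_leq lij.
  rewrite mem_iota add0n ltnS => /= lek ->.
  have [w nzw Dw] := gen_eigenvector_neq0 (eigk k) (nzk k lek).
  exact: mem_eigenvalue_annihilator rE nzw Dw.
by rewrite size_map size_iota ltnn.
Qed.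

Theorem jacobson_closed : lie_nilpotent L.
Proof.
apply: (@engel_weakly_closed _ _ (fun x => exists a, gen_eigenvector d a x)).
- by move=> x y [a xa] [b yb]; exists (a + b); apply: gen_eigenvector_lie.
- move=> Z HZ; apply/subvP=> v _; have [r rE] := closed_eigen_annihilator d.
  have [s sE ->] := foldr_eigen_shift_gen_eigenvector (rE v).
  by rewrite big_seq memv_suml // => x /sE Hx; rewrite HZ ?memvf.
- by move=> x [a]; apply: gen_eigenvector_ad_nilpotent.
Qed.

End JacobsonClosed.

(** * Complexification and descent of nilpotency *)

(** Intended for the inclusion of a real Lie algebra in its complexification, where the scalar field
    changes along [f]. *)
Lemma lower_central_semilinear (K F : fieldType) (f : K -> F)
    (L : lieAlgType K) (M : lieAlgType F) (phi : {additive L -> M}) n x :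
    (forall a y, phi (a *: y) = f a *: phi y) ->
    (forall y z, phi (lie y z) = lie (phi y) (phi z)) ->
  x \in lower_central L n -> phi x \in lower_central M n.
Proof.
move=> phiZ phi_lie; elim: n x => [|n IHn] x; first by move=> _; apply: memvf.
rewrite {1}/lower_central iterS /lie_prod.
move/(@coord_span _ _ _ (in_tuple _)) ->.
rewrite raddf_sum; apply: memv_suml => i _.
rewrite phiZ memvZ //=.
have /allpairsP[[y z] /= [_ Wz ->]] := mem_nth 0 (ltn_ord i).
rewrite phi_lie; apply: lie_prod_mem; first exact: memvf.
exact/IHn/vbasis_mem.
Qed.

(* The pair [(x, y)] stands for [x + i y]. *)
Definition complexified (R : rcfType) (L : lieAlgType R) : Type := (L * L)%type.

Section Complexification.
Variables (R : rcfType) (L : lieAlgType R).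
Local Notation LC := (complexified L).
Implicit Types (p q r : LC) (a b : R[i]).

(** Only the additive group is copied: scalars are to come from [R[i]], not [R]. *)
HB.instance Definition _ := GRing.Zmodule.copy LC (L * L)%type.

Definition complexified_scale a p : LC :=
  (complex.Re a *: p.1 - complex.Im a *: p.2,
   complex.Re a *: p.2 + complex.Im a *: p.1).

Lemma complexified_scaleA a b p :
  complexified_scale a (complexified_scale b p) = complexified_scale (a * b) p.
Proof.
case: a b => [a a'] [b b']; congr pair => /=.
  rewrite scalerBr scalerDr !scalerA scalerBl scalerDl !opprD.
  by rewrite !addrA [LHS](ACl (1*4*2*3)).
rewrite scalerBr scalerDr !scalerA scalerBl scalerDl.
by rewrite !addrA [LHS](ACl (1*4*2*3)).
Qed.

Lemma complexified_scale1 p : complexified_scale 1 p = p.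
Proof.
by case: p => x y; rewrite /complexified_scale /= !scale1r !scale0r subr0 addr0.
Qed.

Lemma complexified_scaleDr a p q :
  complexified_scale a (p + q) = complexified_scale a p + complexified_scale a q.
Proof.
by congr pair => /=; rewrite !scalerDr ?opprD addrACA.
Qed.

Lemma complexified_scaleDl p a b :
  complexified_scale (a + b) p = complexified_scale a p + complexified_scale b p.
Proof.
case: a b => [a a'] [b b'].
by congr pair => /=; rewrite !scalerDl ?opprD addrACA.
Qed.

HB.instance Definition _ := GRing.Zmodule_isLmodule.Build R[i] LC
  complexified_scaleA complexified_scale1 complexified_scaleDr
  complexified_scaleDl.

(** Real coordinates of the two components are the real and imaginary parts of complex ones, so the
    complex dimension is [dim L]. *)
Lemma complexified_vector_axiom : Vector.axiom (dim L) LC.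
Proof.
pose toC (p : LC) : 'rV[R[i]]_(dim L) :=
  \row_j Complex (v2r p.1 0 j) (v2r p.2 0 j).
pose ofC (u : 'rV[R[i]]_(dim L)) : LC :=
  (r2v (map_mx (@complex.Re R) u), r2v (map_mx (@complex.Im R) u)).
exists toC.
  move=> [a a'] p q; apply/rowP=> j; rewrite !mxE /= !linearD linearN !linearZ /=.
  by rewrite !mxE mulrN.
exists ofC => [[x y]|u]; rewrite /ofC /toC.
  congr pair; apply: (can_inj v2rK); rewrite r2vK;
    by apply/rowP=> j; rewrite !mxE.
by apply/rowP=> j; rewrite !mxE !r2vK !mxE; case: (u 0 j).
Qed.

HB.instance Definition _ := Lmodule_hasFinDim.Build R[i] LC
  complexified_vector_axiom.

Definition complexified_lie p q : LC :=
  (lie p.1 q.1 - lie p.2 q.2, lie p.1 q.2 + lie p.2 q.1).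

Lemma complexified_lieDl p q r :
  complexified_lie (p + q) r = complexified_lie p r + complexified_lie q r.
Proof. by congr pair => /=; rewrite !lieDl ?opprD addrACA. Qed.

Lemma complexified_lieDr p q r :
  complexified_lie p (q + r) = complexified_lie p q + complexified_lie p r.
Proof. by congr pair => /=; rewrite !lieDr ?opprD addrACA. Qed.

Lemma complexified_lieZl a p q :
  complexified_lie (a *: p) q = a *: complexified_lie p q.
Proof.
by congr pair; rewrite /= !lieDl !lieNl !lieZl !scalerDr ?scalerN ?opprD !addrA
  [LHS](ACl (1*3*4*2)).
Qed.

Lemma complexified_lieZr a p q :
  complexified_lie p (a *: q) = a *: complexified_lie p q.
Proof.
by congr pair; rewrite /= !lieDr !lieNr !lieZr !scalerDr ?scalerN ?opprD !addrA
  [LHS](ACl (1*3*2*4)).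
Qed.

Lemma complexified_liexx p : complexified_lie p p = 0.
Proof.
by congr pair => /=; rewrite ?liexx ?subrr // [lie p.2 _]lieC subrr.
Qed.

Lemma complexified_jacobi p q r :
  complexified_lie p (complexified_lie q r)
  + complexified_lie q (complexified_lie r p)
  + complexified_lie r (complexified_lie p q) = 0.
Proof.
congr pair; rewrite /= !lieDr !lieNr ?opprD !addrA.
  (* The twelve terms of each component regroup into four real Jacobi identities. *)
  rewrite [LHS](ACl ((1*5*9)*(2*8*11)*(3*6*12)*(4*7*10)))/=.
  by rewrite -!opprD !lie_jacobi !oppr0 !addr0.
rewrite [LHS](ACl ((1*6*11)*(2*7*9)*(3*5*10)*(4*8*12)))/=.
by rewrite -!opprD !lie_jacobi !oppr0 !addr0.
Qed.

HB.instance Definition _ := isLieAlgebra.Build R[i] LC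
  complexified_lieDl complexified_lieZl complexified_lieDr complexified_lieZr
  complexified_liexx complexified_jacobi.

Definition complexified_map (d : 'End(L)) p : LC := (d p.1, d p.2).

Lemma complexified_map_is_linear d : linear (complexified_map d).
Proof. by move=> a p q; congr pair => /=; rewrite !linearD ?linearN !linearZ. Qed.

HB.instance Definition _ d :=
  GRing.isLinear.Build R[i] LC LC _ (complexified_map d)
    (complexified_map_is_linear d).

Definition to_complexified (x : L) : LC := (x, 0).

Lemma to_complexified_is_additive : additive to_complexified.
Proof. by move=> x y; congr pair; rewrite subr0. Qed.

HB.instance Definition _ :=
  GRing.isAdditive.Build L LC to_complexified to_complexified_is_additive.

Lemma complexified_derivation d :
  derivation d -> derivation (linfun (complexified_map d)).
Proof.
move=> der_d p q; rewrite !lfunE; congr pair => /=.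
  by rewrite linearB /= !der_d opprD addrACA.
by rewrite linearD /= !der_d addrACA.
Qed.

(** [d] extends to an injective derivation of the complexification, and the injective map
    [to_complexified] respects lower central series, so their vanishing descends to [L]. *)
Theorem jacobson (d : 'End(L)) :
  derivation d -> (forall x, d x = 0 -> x = 0) -> lie_nilpotent L.
Proof.
move=> der_d inj_d.
have [||n nilLC] := jacobson_closed _ (complexified_derivation der_d).
- exact: pchar_num.
- by case=> x y; rewrite lfunE => -[/inj_d-> /inj_d->].
exists n; apply/eqP; rewrite -subv0; apply/subvP=> x Lx.
have: to_complexified x \in lower_central LC n.
  apply: (@lower_central_semilinear _ _ (real_complex R)) Lx => [a y|y z].
    by congr pair => /=; rewrite ?scaler0 ?scale0r ?subr0 ?addr0.
  by congr pair => /=; rewrite lie0l ?linear0 ?subr0 ?addr0.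
by rewrite nilLC !memv0 => /eqP[->].
Qed.

End Complexification.

(** * Totally real complex structures and derivations *)

Section TotallyReal.
Variables (K : fieldType) (h : lieAlgType K).
Implicit Types (J : 'End(tangent h)) (d : 'End(h)) (x y v w : h).

Lemma totally_real_complex_fibre J x : (J \o J)%VF = - \1%VF ->
  totally_real J -> J (tangent_fibre (restriction J x)) = - tangent_base x.
Proof.
move=> /lfunP/(_ (tangent_base x)) JJ /totally_realE<-.
by move: JJ; rewrite comp_lfunE opp_lfunE id_lfunE.
Qed.

Lemma restriction_inj J : (J \o J)%VF = - \1%VF -> totally_real J ->
  forall x, restriction J x = 0 -> x = 0.
Proof.
move=> JJ tJ x jx; have := totally_real_complex_fibre x JJ tJ.
by rewrite jx !linear0 => /(congr1 fst) /eqP; rewrite eq_sym oppr_eq0 => /eqP.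
Qed.

(** In finite dimension a trivial kernel already gives a two-sided inverse. *)
Lemma nonsingularP (V : vectType K) (d : 'End(V)) :
  nonsingular d <-> forall x : V, d x = 0 -> x = 0.
Proof.
split=> [[e [ed _]] x dx | inj_d].
  by have /lfunP/(_ x) := ed; rewrite comp_lfunE id_lfunE dx linear0.
have kd : lker d == 0%VS.
  by rewrite -subv0; apply/subvP=> x; rewrite memv_ker memv0 => /eqP/inj_d->.
by exists d^-1%VF; rewrite lker0_compVf ?lker0_compfV.
Qed.

Lemma restriction_derivation J :
  complex_structure J -> totally_real J -> derivation (restriction J).
Proof.
move=> [JJ intJ] tJ x y; set j := restriction J.
have := intJ (tangent_base x) (tangent_base y).
rewrite !(totally_realE _ tJ) -/j.
have -> : lie (tangent_fibre (j x)) (tangent_fibre (j y)) = 0.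
  by congr pair => /=; rewrite ?lie0l ?subrr.
have -> : lie (tangent_base x) (tangent_base y) = tangent_base (lie x y).
  by congr pair => /=; rewrite !linear0 addr0.
have -> : lie (tangent_fibre (j x)) (tangent_base y)
    = tangent_fibre (lie (j x) y).
  by congr pair => /=; rewrite lie0l // sub0r -lieC.
have -> : lie (tangent_base x) (tangent_fibre (j y))
    = tangent_fibre (lie x (j y)).
  by congr pair => /=; rewrite linear0 // subr0.
(* Applying [J] once more removes it from the two mixed brackets and puts it on [[x, y]]; the second
   component is then the Leibniz rule for [j]. *)
move/(congr1 J); rewrite !linearB linear0 sub0r /= (totally_realE _ tJ) -/j.
have JJE p : J (J p) = - p.
  by have /lfunP/(_ p) := JJ; rewrite comp_lfunE opp_lfunE id_lfunE.
rewrite !JJE !opprK linear0 => /(congr1 snd) /= /eqP.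
by rewrite -addrA addrC subr_eq0 => /eqP.
Qed.

(** [j] fixes [J] on h, and also on V: every [v] is some [j x], and [J (0, j x) = - (x, 0)]. *)
Lemma eq_totally_real J J' :
    complex_structure J -> totally_real J ->
    complex_structure J' -> totally_real J' ->
  restriction J = restriction J' -> J = J'.
Proof.
move=> [JJ _] tJ [JJ' _] tJ' eqj; apply/lfunP=> -[x v].
have [e [_ je]] := (nonsingularP _).2 (restriction_inj JJ tJ).
have -> : (x, v) = tangent_base x + tangent_fibre (restriction J (e v))
    :> tangent h.
  have /lfunP/(_ v) := je; rewrite comp_lfunE id_lfunE => ->.
  by congr pair; rewrite ?addr0 ?add0r.
rewrite !linearD /= (totally_real_complex_fibre _ JJ tJ) eqj.
by rewrite (totally_real_complex_fibre _ JJ' tJ') !totally_realE ?eqj.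
Qed.

Section Extension.
Variables (d e : 'End(h)).
Hypotheses (ed : (e \o d = \1)%VF) (de : (d \o e = \1)%VF).

Definition totally_real_ext (p : tangent h) : tangent h := (- e p.2, d p.1).

Lemma totally_real_ext_is_linear : linear totally_real_ext.
Proof.
by move=> a p q; congr pair => /=; rewrite linearP // opprD scalerN.
Qed.

HB.instance Definition _ :=
  GRing.isLinear.Build K (tangent h) (tangent h) _ totally_real_ext
    totally_real_ext_is_linear.

Let edE x : e (d x) = x.
Proof. by have /lfunP/(_ x) := ed; rewrite comp_lfunE id_lfunE. Qed.

Let deE x : d (e x) = x.
Proof. by have /lfunP/(_ x) := de; rewrite comp_lfunE id_lfunE. Qed.

Lemma restriction_totally_real_ext : restriction (linfun totally_real_ext) = d.
Proof. by apply/lfunP=> x; rewrite restrictionE lfunE. Qed.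

Lemma totally_real_totally_real_ext : totally_real (linfun totally_real_ext).
Proof.
apply/vspaceP=> p; apply/memv_imgP/memv_imgP=> -[q].
  case/memv_imgP=> x _ -> ->; exists (d x); first exact: memvf.
  by rewrite !lfunE /=; congr pair; rewrite /= linear0 oppr0.
move=> _ ->; exists (tangent_base (e q)).
  by rewrite -(lfunE (@tangent_base K h)) memv_img ?memvf.
by rewrite !lfunE; congr pair; rewrite /= ?linear0 ?oppr0 ?deE.
Qed.

Lemma complex_totally_real_ext :
  derivation d -> complex_structure (linfun totally_real_ext).
Proof.
move=> der_d; split.
  apply/lfunP=> -[x v]; rewrite comp_lfunE opp_lfunE id_lfunE !lfunE.
  by congr pair; rewrite /= ?edE // linearN /= deE.
(* Writing [v = d a] and [w = d b] clears most occurrences of the inverse [e]. *)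
move=> [x v] [y w]; rewrite -(deE v) -(deE w).
move: (e v) (e w) => a b; rewrite !lfunE.
congr pair; rewrite /= !edE.
  rewrite !lieNl !lieNr !opprK -addrA -linearD.
  (* The arguments of [e] add up to a value of [d], which [e] undoes. *)
  have -> : - lie a (d b) - lie y (d x) + (lie x (d y) + lie b (d a))
      = d (lie x y - lie a b).
    rewrite linearB /= !der_d [lie (d x) y]lieC [lie (d a) b]lieC.
    by rewrite opprD opprK !addrA [LHS](ACl (2*3*4*1)).
  by rewrite /= edE -[lie x y - _]opprB subrr.
rewrite !lieNl !lieNr !linearN /= !opprK !der_d.
rewrite [lie (d a) y]lieC [lie (d x) b]lieC opprD opprK !addrA.
by rewrite [LHS](ACl ((6*1)*(2*7)*(8*3)*(4*5))) /= !subrr !addr0.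
Qed.

End Extension.
End TotallyReal.

(** * The bijection and its consequence for nilpotency *)

Local Open Scope classical_set_scope.

Theorem theorem3p5 (R : realType) (h : lieAlgType R) :
  set_bij (totally_real_complex_structures h) (nonsingular_derivations h)
    (@restriction R h)
  /\ (totally_real_complex_structures h !=set0 <->
      nonsingular_derivations h !=set0)
  /\ (totally_real_complex_structures h !=set0 \/
      nonsingular_derivations h !=set0 -> lie_nilpotent h).
Proof.
have fun_r J : totally_real_complex_structures h J ->
    nonsingular_derivations h (restriction J).
  move=> [csJ tJ]; split; first exact: restriction_derivation.
  by apply/nonsingularP/restriction_inj => //; case: csJ.
have surj_r d : nonsingular_derivations h d ->
    exists2 J, totally_real_complex_structures h J & restriction J = d.
  move=> [der_d [e [ed de]]]; exists (linfun (totally_real_ext d e)).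
    split; first exact: complex_totally_real_ext.
    exact: totally_real_totally_real_ext.
  exact: restriction_totally_real_ext.
have nil d : nonsingular_derivations h d -> lie_nilpotent h.
  by move=> [der_d /nonsingularP]; apply: jacobson.
split; [split | split; [split |]].
- by move=> J /fun_r.
- move=> J J' /set_mem[csJ tJ] /set_mem[csJ' tJ'].
  exact: eq_totally_real.
- by move=> d /surj_r.
- by case=> J /fun_r; exists (restriction J).
- by case=> d /surj_r[J HJ _]; exists J.
- by case=> [[J /fun_r /nil]|[d /nil]].
Qed.
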